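(* Let $A_n$ be the connected anti-regular graph with $n=2k$ vertices. Let its positive eigenvalues be $\lambda^+_1<\dots<\lambda^+_k$ and its negative eigenvalues other than $-1$ be $\lambda^-_{k-1}<\dots<\lambda^-_1$. Let \[f_1(\theta)=\frac{-(\cos\theta+1)+\sqrt{(\cos\theta+1)(\cos\theta+3)}}{2(\cos\theta+1)},\quad \theta\in[0,\pi),\] with derivative $f_1'$, and let $\gamma_j=\frac{2\pi j}{2k-1}$. Then for all $1\le j\le k-1$, \[|\lambda^+_j+\lambda^-_j+1|\le\frac{4\pi f_1'(\gamma_j)}{2k-1}.\] In particular, for fixed $r\in(0,1)$ and $\varepsilon>0$, if $k$ is such that $\frac{4\pi f_1'(r\pi)}{2k-1}<\varepsilon$, then $|\lambda^+_j+\lambda^-_j+1|<\varepsilon$ for all $1\le j\le\frac{(2k-1)r}{2}$.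
   Context: A simple graph is anti-regular if exactly two of its vertices have the same degree. For each $n\ge2$, $A_n$ denotes the unique (up to isomorphism) connected anti-regular graph on $n$ vertices; for $n$ even it is the threshold graph with creation sequence $(0,1,0,1,\dots,0,1)$, where a $1$ means the new vertex is joined to all previous vertices and a $0$ means it is added isolated. Eigenvalues are those of the adjacency matrix; for $n=2k$ they are simple and consist of $-1$, $k$ positive and $k-1$ other negative eigenvalues. *)

(* Defs.v *)
From HB Require Import structures.
From mathcomp Require Import all_boot all_order all_algebra.
From mathcomp Require Import all_classical all_reals all_analysis.

Set Implicit Arguments.
Unset Strict Implicit.
Unset Printing Implicit Defensive.

Import Order.TTheory GRing.Theory Num.Theory.
Import numFieldNormedType.Exports.

Local Open Scope ring_scope.

Definition simple_graph (n : nat) (e : rel 'I_n) : Prop :=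
  symmetric e /\ irreflexive e.

Definition connected_graph (n : nat) (e : rel 'I_n) : Prop :=
  forall x y, connect e x y.

Definition degree (n : nat) (e : rel 'I_n) (x : 'I_n) : nat := #|e x|.

(* Exactly one unordered pair of distinct vertices has a common degree. *)
Definition antiregular (n : nat) (e : rel 'I_n) : Prop :=
  exists u v : 'I_n, u != v /\
    forall x y : 'I_n, x != y ->
      (degree e x = degree e y <-> [set x; y]%SET = [set u; v]%SET).

(* [e] is A_n, i.e. a labelling of it by 0, ..., n-1; the spectrum of the
   adjacency matrix does not depend on the labelling. *)
Definition is_A (n : nat) (e : rel 'I_n) : Prop :=
  [/\ simple_graph e, connected_graph e & antiregular e].

Definition adjacency (R : realType) (n : nat) (e : rel 'I_n) : 'M[R]_n :=
  \matrix_(i, j) (e i j)%:R.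

(* l 1 < ... < l k are exactly the positive eigenvalues of A; the values of l
   outside 1, ..., k are irrelevant. *)
Definition positive_eigenvalues (R : realType) (n : nat) (A : 'M[R]_n)
    (k : nat) (l : nat -> R) : Prop :=
  (forall i j : nat, (1 <= i)%N -> (i < j)%N -> (j <= k)%N -> l i < l j) /\
  (forall x : R, eigenvalue A x /\ 0 < x <->
     exists i : nat, (1 <= i <= k)%N /\ x = l i).

(* l k < ... < l 1 are exactly the negative eigenvalues of A other than -1. *)
Definition negative_eigenvalues (R : realType) (n : nat) (A : 'M[R]_n)
    (k : nat) (l : nat -> R) : Prop :=
  (forall i j : nat, (1 <= i)%N -> (i < j)%N -> (j <= k)%N -> l j < l i) /\
  (forall x : R, [/\ eigenvalue A x, x < 0 & x <> -1] <->
     exists i : nat, (1 <= i <= k)%N /\ x = l i).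

(* Only used on [0, pi[, where cos t + 1 > 0. *)
Definition f1 (R : realType) (t : R) : R :=
  (- (cos t + 1) + Num.sqrt ((cos t + 1) * (cos t + 3))) / (2 * (cos t + 1)).
Arguments f1 : clear implicits.

Definition gamma (R : realType) (k j : nat) : R :=
  2 * pi * j%:R / (2 * k%:R - 1).

(* Main.v *)
Require Import Defs.
From HB Require Import structures.
From mathcomp Require Import all_boot all_order all_algebra.
From mathcomp Require Import all_classical all_reals all_analysis.
From mathcomp Require Import ring lra zify.

Set Implicit Arguments.
Unset Strict Implicit.
Unset Printing Implicit Defensive.

Import Order.TTheory GRing.Theory Num.Theory.
Import numFieldNormedType.Exports.

Local Open Scope ring_scope.

(* Ranking the vertices by degree, 0 <= rk < n = 2 k, anti-regularity forces
   e i j <-> i <> j /\ rk i + rk j >= n - 1.  Differences of consecutive rows of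
   the eigenvalue equation then give a Chebyshev recurrence: with
   4 cos^2 u x (x + 1) = 1 and N = 2 k - 1, the function equal to
   (-1)^r sin ((2 r + 2) u) at the ranks r < k extends to an eigenvector for x
   as soon as 2 x cos u sin (N u) = sin (2 k u).  The two solutions in x are
   f1 (2 u) and - 1 - f1 (2 u); for either one the end condition changes sign
   between consecutive points pi j / N, so that each interval contains a
   solution u.  This gives k positive eigenvalues and k - 1 eigenvalues smaller
   than - 1, hence all of them and in order.  Thus lp j + lm j + 1 is
   f1 (2 u) - f1 (2 v) with 2 u and 2 v in the same interval of length
   2 pi / N with right end gamma j, and the bound follows because f1' increases. *)

(** * Ranking the vertices of an anti-regular graph by degree *)

Lemma degree_gt0 (n : nat) (e : rel 'I_n) (x : 'I_n) :
  (1 < n)%N -> connected_graph e -> (0 < degree e x)%N.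
Proof.
move=> n1 econ.
have [y yx] : exists y : 'I_n, y != x.
  apply/existsP; rewrite -[[exists _, _]]negbK negb_exists; apply/negP.
  move/forallP=> all_x; have : (#|'I_n| <= 1)%N.
    apply/card_le1_eqP => y z _ _.
    by have /negPn/eqP-> := all_x y; have /negPn/eqP-> := all_x z.
  by rewrite card_ord leqNgt n1.
have /connectP[[|z p] /= exp yE] := econ x y; first by rewrite yE eqxx in yx.
by case/andP: exp => exz _; apply/card_gt0P; exists z.
Qed.

Lemma degree_lt (n : nat) (e : rel 'I_n) (x : 'I_n) :
  irreflexive e -> (degree e x < n)%N.
Proof.
move=> eirr; rewrite -[X in (_ < X)%N]card_ord; apply: proper_card.
apply/properP; split; first exact/subset_predT.
by exists x => //; rewrite unfold_in eirr.
Qed.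

Lemma card_ord_leq (n t : nat) : #|[pred r : 'I_n | (t <= r)%N]| = (n - t)%N.
Proof.
have [tn|nt] := leqP t n; last first.
  rewrite (_ : n - t = 0)%N; last lia.
  by apply: eq_card0 => r; rewrite !inE; have := ltn_ord r; lia.
rewrite -sum1_card -(big_mkord (fun i => t <= i)%N (fun=> 1%N)).
rewrite (big_cat_nat (n := t)) //= big_nat_cond big_pred0 => [|i]; last lia.
rewrite add0n big_nat_cond (eq_bigl (fun i => t <= i < n)%N) => [|i]; last lia.
by rewrite -big_nat sum_nat_const_nat muln1.
Qed.

(* The repeated degree m is not known in advance.  The ranks are settled in pairs
   t, n - 1 - t from the outside in: the rank n - 1 - t has all the neighbours
   that are still allowed, and then the rank t already has all of its own. *)
Lemma antiregular_rank (n k : nat) (e : rel 'I_n) :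
  n = (2 * k)%N -> (1 <= k)%N -> is_A e ->
  exists rk : 'I_n -> 'I_n, bijective rk /\
    forall x y, e x y = (x != y) && (n - 1 <= rk x + rk y)%N.
Proof.
move=> nE k1 [[esym eirr] econ [u [v [uv deg_uv]]]].
have n1 : (1 < n)%N by lia.
have d_gt0 x : (0 < degree e x)%N by exact: degree_gt0.
have d_lt x : (degree e x < n)%N by exact: degree_lt.
have d_inj x y : x != v -> y != v -> degree e x = degree e y -> x = y.
  move=> xv yv dxy; apply/eqP; apply: contraT => xy.
  have /(deg_uv _ _ xy)/setP/(_ v) := dxy.
  by rewrite !inE eqxx orbT eq_sym (negbTE xv) eq_sym (negbTE yv).
pose m := degree e v.
have [rk rk_inj degE] : exists2 rk : 'I_n -> 'I_n, injective rk &
    forall x, degree e x = (if rk x < m then (rk x).+1 else rk x)%N.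
  (* The vertex [v] is inserted just above its twin [u]: degrees up to [m] shift down by one, which
     frees the rank [m]. *)
  pose rkn x := if x == v then m else
    if (degree e x <= m)%N then (degree e x).-1 else degree e x.
  have rkn_lt x : (rkn x < n)%N.
    rewrite /rkn; have := d_gt0 x; have := d_lt x; have := d_lt v.
    by rewrite -/m; case: ifP => _; [|case: ifP]; lia.
  pose rk x := Ordinal (rkn_lt x).
  exists rk => [|x].
  - move=> x y /(congr1 val)/=; rewrite /rkn.
    case: eqVneq => [->|xv]; case: eqVneq => [->|yv] //.
    - by have := d_gt0 y; case: ifP; lia.
    - by have := d_gt0 x; case: ifP; lia.
    move=> E; apply: d_inj => //; move: E.
    by have := d_gt0 y; have := d_gt0 x; case: ifP; case: ifP; lia.
  - rewrite /= /rkn; have := d_gt0 x; case: eqVneq => [->|xv]; first by rewrite ltnn.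
    by case: (leqP (degree e x) m) => dxm; case: ifP; lia.
have rk_bij : bijective rk by exact: injF_bij.
exists rk; split=> //.
have card_rk (P : pred 'I_n) : #|[pred x | P (rk x)]| = #|P|.
  by rewrite -(on_card_preimset (f := rk) (R := P)) ?cardsE //; apply: onW_bij.
have card_ge t : #|[pred x | t <= rk x]%N| = (n - t)%N.
  by rewrite -[RHS]card_ord_leq -(card_rk [pred r : 'I_n | t <= r]%N).
have P t : (t <= k)%N -> forall x y, (rk x < t)%N || (n - t <= rk x)%N ->
    e x y = (x != y) && (n - 1 <= rk x + rk y)%N.
  elim: t => [|t IH] tk x y; first by have := ltn_ord (rk x); lia.
  have {}IH := IH (ltnW tk).
  have top x' : (rk x' = n - t.+1 :> nat)%N ->
      forall y', e x' y' = (x' != y') && (t <= rk y')%N.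
    move=> rx'.
    have sub : {subset e x' <= [pred y' | (x' != y') && (t <= rk y')%N]}.
      move=> y' exy; rewrite !inE; move: (exy : e x' y' = true) => exy'.
      case: eqVneq exy' => [->|xy exy']; first by rewrite eirr.
      rewrite leqNgt; apply/negP => yt; move: exy'.
      by rewrite esym IH ?yt // => /andP[_]; lia.
    move=> y'; apply/idP/idP => [exy|]; first exact: (sub y' exy).
    have cE : #|[pred y' | (x' != y') && (t <= rk y')%N]| = (n - t.+1)%N.
      rewrite (eq_card (B := [predD1 [pred y' | (t <= rk y')%N] & x'])).
        have := cardD1 x' [pred y' | (t <= rk y')%N]; rewrite card_ge inE rx'.
        by move: #|_| => c; lia.
      by move=> z; rewrite !inE eq_sym.
    (* By [degE] a degree is never below the rank, which here equals the number of candidates; so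
       every candidate is a neighbour. *)
    have /subset_cardP E :
        #|e x'| = #|[pred y' | (x' != y') && (t <= rk y')%N]|.
      apply/eqP; rewrite eqn_leq; apply/andP; split.
        by apply: subset_leq_card; apply/fintype.subsetP.
      by rewrite cE; have := degE x'; rewrite /degree rx'; case: ifP; lia.
    have /E/(_ y') : e x' \subset [pred y' | (x' != y') && (t <= rk y')%N].
      exact/fintype.subsetP.
    by rewrite inE => <-.
  have [rx|rxn] := eqVneq (rk x : nat) (n - t.+1)%N.
    by move=> _; rewrite top // rx; congr andb; lia.
  have [rx|rxt] := eqVneq (rk x : nat) t; last first.
    by move=> rx; apply: IH; lia.
  move=> _.
  have sub : {subset [pred y' | (n - t.+1 <= rk y')%N] <= e x}.
    move=> y'; rewrite inE => ry'; rewrite unfold_in.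
    have xy' : y' != x by apply: contraTneq ry' => ->; rewrite rx; lia.
    rewrite esym; have [ry|ry] := eqVneq (rk y' : nat) (n - t.+1)%N.
      by rewrite top // xy' rx leqnn.
    by rewrite IH ?xy' /= ?rx; lia.
  have ryx : (n - t.+1 <= rk y)%N -> x != y.
    by apply: contraTneq => <-; rewrite rx; lia.
  rewrite [RHS](_ : _ = (n - t.+1 <= rk y)%N); last first.
    apply/idP/idP => [/andP[_]|ry]; first by rewrite rx; lia.
    by rewrite ryx //= rx; lia.
  (* By [degE] a degree exceeds the rank by at most one. As [t.+1] neighbours are already known,
     there are no others. *)
  have /subset_cardP E : #|[pred y' | (n - t.+1 <= rk y')%N]| = #|e x|.
    apply/eqP; rewrite eqn_leq; apply/andP; split.
      by apply: subset_leq_card; apply/fintype.subsetP.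
    by rewrite card_ge; have := degE x; rewrite /degree rx; case: ifP; lia.
  have /E/(_ y) : [pred y' | (n - t.+1 <= rk y')%N] \subset e x.
    exact/fintype.subsetP.
  by rewrite inE => ->.
move=> x y; apply: (P k (leqnn k)); lia.
Qed.

(** * Eigenvectors through tail sums *)

(** Up to a diagonal term, a row of the eigenvalue equation is a sum over all ranks from some [m]
    on; a closed form [V] of these sums is verified by its differences. *)
Lemma tail_sum_telescope (R : zmodType) (n : nat) (w V : nat -> R) (m : nat) :
  (m <= n)%N -> V n = 0 -> (forall s, (s < n)%N -> V s - V s.+1 = w s) ->
  \sum_(s < n | (m <= s)%N) w s = V m.
Proof.
move=> mn Vn VE.
rewrite -(big_mkord (fun s => m <= s)%N w) (big_cat_nat (n := m)) //=.
rewrite big_nat_cond big_pred0 => [|s]; last by lia.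
rewrite add0r big_nat_cond (eq_bigl (fun s => m <= s < n)%N) => [|s]; last by lia.
rewrite -big_nat (eq_big_nat _ _ (F2 := fun s => - (V s.+1 - V s))).
  by rewrite sumrN telescope_sumr // Vn sub0r opprK.
by move=> s /andP[_ sn]; rewrite opprB VE.
Qed.

(* [u] is half of the angle theta of the statement, [a i] and [b i] are the
   values of the eigenvector at the ranks i and 2 k - 1 - i, and [V] is its tail
   sum, so that row r of the eigenvalue equation is [V_end]. *)
Lemma eigenvalue_antiregular (R : realType) (n k : nat) (e : rel 'I_n)
    (rk : 'I_n -> 'I_n) (x u : R) :
  n = (2 * k)%N -> (1 <= k)%N -> bijective rk ->
  (forall i j, e i j = (i != j) && (n - 1 <= rk i + rk j)%N) ->
  sin (u *+ 2) != 0 ->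
  4 * cos u ^+ 2 * (x * (x + 1)) = 1 ->
  2 * x * cos u * sin ((2 * k - 1)%:R * u) = sin ((2 * k)%:R * u) ->
  eigenvalue (adjacency R e) x.
Proof.
move=> nE k1 rk_bij eE su xx end_eq.
pose a i : R := (-1) ^+ i * sin ((2 * i + 2)%:R * u).
pose b i : R := (-1) ^+ i * (2 * x * cos u * sin ((2 * i + 1)%:R * u)).
pose w r := if (r < k)%N then a r else b (2 * k - 1 - r)%N.
pose V r := if (r < k)%N then (x + 1) * b r
            else if r == (2 * k)%N then 0 else x * a (2 * k - 1 - r)%N.
have sum_sin (m : nat) : sin ((m + 2)%:R * u) + sin (m%:R * u) =
    2 * cos u * sin ((m + 1)%:R * u).
  have -> : (m + 2)%:R * u = (m + 1)%:R * u + u by rewrite !natrD; ring.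
  have -> : m%:R * u = (m + 1)%:R * u - u by rewrite !natrD; ring.
  rewrite sinD sinB; ring.
have a0 : x * a 0%N = b 0%N.
  have := sum_sin 0%N; rewrite mul0r sin0 /a /b => E.
  rewrite muln0 expr0 !mul1r; move: E; rewrite !add0n addr0 => ->; rewrite !mul1r; ring.
have aS i : x * a i.+1 - x * a i = b i.+1.
  rewrite /a /b exprS.
  have -> : (2 * i.+1 + 2 = (2 * i + 2) + 2)%N by lia.
  have -> : (2 * i.+1 + 1 = (2 * i + 2) + 1)%N by lia.
  have := sum_sin (2 * i + 2)%N => /(canRL (addrK _)) ->; ring.
(* The relation between [x] and [u] enters here: the sum of two sines brings a second factor
   [2 * cos u], and the factors multiply to 1. *)
have bS i : (x + 1) * b i - (x + 1) * b i.+1 = a i.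
  rewrite /a /b exprS.
  have -> : (2 * i.+1 + 1 = (2 * i + 1) + 2)%N by lia.
  have -> : (2 * i + 2 = (2 * i + 1) + 1)%N by lia.
  have := sum_sin (2 * i + 1)%N => /(canRL (addrK _)) ->.
  by rewrite -[RHS]mul1r -[X in _ = X * _]xx; ring.
(* The end condition says that the vector agrees at the two middle ranks [k - 1] and [k], where its
   two halves meet. *)
have ab : a k.-1 = b k.-1.
  rewrite /a /b -(_ : 2 * k - 1 = 2 * k.-1 + 1)%N; last by lia.
  by rewrite -(_ : 2 * k = 2 * k.-1 + 2)%N ?end_eq //; lia.
have V2k : V (2 * k)%N = 0 by rewrite /V eqxx ifF //; lia.
have VE s : (s < 2 * k)%N -> V s - V s.+1 = w s.
  move=> sk; rewrite /V /w; have [s1k|ks1] := ltnP s.+1 k.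
    by rewrite !(ltnW s1k) bS.
  have [sk'|ks] := ltnP s k.
    have sE : s = k.-1 by lia.
    rewrite ifF; last by lia.
    have -> : (2 * k - 1 - s.+1 = k.-1)%N by lia.
    by rewrite sE ab; ring.
  rewrite ifF; last by lia.
  case: eqVneq => [s2k|s2k]; last first.
    by rewrite (_ : 2 * k - 1 - s = (2 * k - 1 - s.+1).+1)%N ?aS //; lia.
  by rewrite (_ : 2 * k - 1 - s = 0)%N ?a0 ?subr0 //; lia.
have V_end r : (r < 2 * k)%N ->
    V (2 * k - 1 - r)%N = x * w r + (if (k <= r)%N then w r else 0).
  move=> r2k; rewrite /V /w; have [rk'|kr] := ltnP r k.
    rewrite ifF; last by lia.
    rewrite ifF; last by lia.
    by rewrite addr0 (_ : 2 * k - 1 - (2 * k - 1 - r) = r)%N //; lia.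
  by rewrite ifT; [ring|lia].
have [rk' rkK rk'K] := rk_bij.
pose v : 'rV[R]_n := \row_i w (rk i).
have sum_w (m : nat) : (m <= n)%N -> \sum_(r < n | (m <= r)%N) w r = V m.
  by rewrite nE => mk; apply: tail_sum_telescope.
apply/eigenvalueP; exists v; last first.
  have n0 : (0 < n)%N by lia.
  (* The entry at rank 0 is sin (2 u), so the vector is nonzero. *)
  apply: contra_neq su => /rowP /(_ (rk' (Ordinal n0))).
  by rewrite !mxE rk'K /w /= k1 /a expr0 mul1r muln0 add0n mulr_natl.
apply/rowP => j; rewrite !mxE.
rewrite (reindex rk') /=; last by apply: onW_bij; exists rk.
(* The tail contains the vertex itself exactly when its rank is at least [k]; that term is
   subtracted because there are no loops. *)
transitivity (\sum_(r < n | (n - 1 - rk j <= r)%N) w r -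
  (if (k <= rk j)%N then w (rk j) else 0)).
  apply/eqP; rewrite eq_sym subr_eq big_mkcond /=; apply/eqP.
  rewrite (bigD1 (rk j)) //= [in RHS](bigD1 (rk j)) //= !mxE eE rk'K rkK eqxx mulr0 add0r.
  rewrite addrC; congr (_ + _).
    apply: eq_bigr => r rj; rewrite !mxE eE rk'K.
    rewrite (_ : rk' r != j) /=; last by rewrite (can2_eq rk'K rkK).
    rewrite (_ : (n - 1 - rk j <= r) = (n - 1 <= r + rk j))%N; last by lia.
    by case: ifP => _; rewrite ?mulr1 ?mulr0.
  by congr (if _ then _ else _); have := ltn_ord (rk j); lia.
rewrite sum_w; last by lia.
have -> : (n - 1 - rk j = 2 * k - 1 - rk j)%N by lia.
by rewrite V_end ?addrK //; have := ltn_ord (rk j); lia.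
Qed.

(** * The derivative of [f1]: sign and monotonicity *)

(** Since sin t > 0 on this interval, the derivative can be written as a square root of an
    expression in [cos t] alone, which makes its monotonicity visible. *)
Lemma is_derive_f1 (R : realType) (t : R) : 0 < t < pi ->
  is_derive t 1 (f1 R)
    (Num.sqrt ((1 - cos t) / ((cos t + 1) ^+ 2 * (cos t + 3))) / 2).
Proof.
move=> t0pi; have s0 : 0 < sin t by exact: sin_gt0_pi.
have cs := cos2Dsin2 t.
have c1 : -1 < cos t by have := cos_geN1 t; nra.
have c2 : cos t < 1 by have := cos_le1 t; nra.
have q0 : 0 < (cos t + 1) * (cos t + 3) by nra.
set S := Num.sqrt ((cos t + 1) * (cos t + 3)).
have S0 : 0 < S by rewrite sqrtr_gt0.
have dq : is_derive t 1 (fun x : R => (cos x + 1) * (cos x + 3)) (- sin t * (2 * cos t + 4)).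
  apply: is_derive_eq; rewrite /GRing.scale /=; ring.
have dsq := @is_derive1_comp R Num.sqrt (fun x => (cos x + 1) * (cos x + 3)) t _ _
  (is_derive1_sqrt q0) dq.
rewrite /comp -/S in dsq.
have D0 : 2 * (cos t + 1) != 0 by apply/eqP; lra.
have dD : is_derive t 1 (fun x : R => 2 * (cos x + 1)) (- (2 * sin t)).
  apply: is_derive_eq; rewrite /GRing.scale /=; ring.
have dV := @is_deriveV R (fun x => 2 * (cos x + 1)) t _ 1 D0 dD.
have S2 : S ^+ 2 = (cos t + 1) * (cos t + 3) by rewrite sqr_sqrtr ?ltW.
rewrite (_ : Num.sqrt _ = sin t / (S * (cos t + 1))); last first.
  rewrite -[RHS]ger0_norm; last by rewrite divr_ge0 ?mulr_ge0//; lra.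
  rewrite -sqrtr_sqr; congr Num.sqrt.
  rewrite expr_div_n exprMn S2 sin2cos2.
  field; apply/andP; split; apply/eqP; nra.
rewrite /f1; apply: is_derive_eq; rewrite /GRing.scale /= -/S.
field: S2.
by rewrite !gt_eqF //; lra.
Qed.

Lemma f1_MVT (R : realType) (a b : R) : 0 < a -> a < b -> b < pi ->
  exists2 c, a < c < b & f1 R b - f1 R a = derive1 (f1 R) c * (b - a).
Proof.
move=> a0 ab bpi.
have df x : a <= x <= b -> is_derive x 1 (f1 R) (derive1 (f1 R) x).
  move=> /andP[ax xb]; rewrite derive1E; apply: derivableP.
  by have [] := @is_derive_f1 R x; first by apply/andP; split; lra.
have [c cab E] : exists2 c, c \in `]a, b[ &
    f1 R b - f1 R a = derive1 (f1 R) c * (b - a).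
  apply: (MVT ab) => [x|].
    by rewrite in_itv /= => /andP[ax xb]; apply: df; rewrite !ltW.
  apply: derivable_within_continuous => x; rewrite in_itv /= => xab.
  by have [] := df x xab.
by exists c; rewrite // in_itv /= in cab.
Qed.

Lemma derive1_f1 (R : realType) (t : R) : 0 < t < pi -> derive1 (f1 R) t =
  Num.sqrt ((1 - cos t) / ((cos t + 1) ^+ 2 * (cos t + 3))) / 2.
Proof. by move=> /is_derive_f1 [_ <-]; rewrite derive1E. Qed.

Lemma cos_itv (R : realType) (t : R) : 0 < t < pi -> -1 < cos t < 1.
Proof.
move=> /andP[t0 tpi]; have pi0 := pi_gt0 R.
apply/andP; split; [rewrite -[X in X < _]cospi | rewrite -[X in _ < X]cos0];
  by rewrite ltr_cos ?in_itv /= ?lexx ?(ltW pi0) ?(ltW t0) ?(ltW tpi).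
Qed.

Lemma derive1_f1_gt0 (R : realType) (t : R) : 0 < t < pi -> 0 < derive1 (f1 R) t.
Proof.
move=> t0pi; rewrite derive1_f1 //; have /andP[c1 c2] := cos_itv t0pi.
rewrite divr_gt0 // sqrtr_gt0 divr_gt0 ?mulr_gt0 ?exprn_gt0 //; lra.
Qed.

(** As [cos] decreases, the numerator under the root grows and the positive denominator shrinks. *)
Lemma derive1_f1_le (R : realType) (s t : R) : 0 < s -> s <= t -> t < pi ->
  derive1 (f1 R) s <= derive1 (f1 R) t.
Proof.
move=> s0 st tpi; rewrite !derive1_f1; try by apply/andP; split; lra.
have /andP[cs1 cs2] : -1 < cos s < 1 by apply: cos_itv; apply/andP; split; lra.
have /andP[ct1 ct2] : -1 < cos t < 1 by apply: cos_itv; apply/andP; split; lra.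
have cst : cos t <= cos s.
  rewrite leNgt ltr_cos ?in_itv /= -?leNgt //; apply/andP; split; lra.
rewrite ler_pM2r ?invr_gt0 // ler_wsqrtr //.
apply: ler_pM; [lra | by rewrite invr_ge0 mulr_ge0 ?sqr_ge0 //; lra | lra |].
rewrite lef_pV2 ?posrE ?mulr_gt0 ?exprn_gt0 //; try lra.
apply: ler_pM; [by rewrite exprn_ge0 //; lra | lra | | lra].
by rewrite lerXn2r ?nnegrE //; lra.
Qed.

Lemma f1_lt (R : realType) (a b : R) : 0 < a -> a < b -> b < pi ->
  f1 R a < f1 R b.
Proof.
move=> a0 ab bpi; have [c /andP[ac cb] E] := f1_MVT a0 ab bpi.
rewrite -subr_gt0 E mulr_gt0 ?subr_gt0 // derive1_f1_gt0 //.
by apply/andP; split; lra.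
Qed.

(** The mean value theorem gives the derivative at an intermediate point, and monotonicity bounds it
    by the value at [c]. *)
Lemma f1_lipschitz (R : realType) (a b c : R) :
  0 < a <= c -> 0 < b <= c -> c < pi ->
  `|f1 R a - f1 R b| <= derive1 (f1 R) c * `|a - b|.
Proof.
move=> + + cpi; wlog ba : a b / b <= a => [wl|].
  case/orP: (le_total b a) => [|ab ha hb]; first exact: wl.
  by rewrite distrC [X in _ * X]distrC; exact: wl.
move=> /andP[a0 ac] /andP[b0 bc].
move: ba; rewrite le_eqVlt => /predU1P[->|ba]; first by rewrite !subrr normr0 mulr0.
have api : a < pi by lra.
have [x /andP[bx xa] ->] := f1_MVT b0 ba api.
rewrite normrM ler_wpM2r // gtr0_norm.
  by apply: derive1_f1_le; lra.
by apply: derive1_f1_gt0; apply/andP; split; lra.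
Qed.

(** * The end condition: sign changes and roots *)

(** Half-angle formulas exhibit [f1 R (u *+ 2)] as the positive root x of 4 cos^2 u x (x + 1) =
    1. *)
Lemma f1_double (R : realType) (u : R) : 0 < u < pi / 2 ->
  f1 R (u *+ 2) = (-1 + Num.sqrt (1 + cos u ^+ 2) / cos u) / 2.
Proof.
move=> /andP[u0 upi]; have c0 : 0 < cos u.
  by apply: cos_gt0_pihalf; apply/andP; split; lra.
rewrite /f1 cos_mulr2n.
have -> : (cos u ^+ 2 *+ 2 - 1 + 1) * (cos u ^+ 2 *+ 2 - 1 + 3) =
    (2 * cos u) ^+ 2 * (1 + cos u ^+ 2) by ring.
rewrite sqrtrM ?sqr_ge0 // sqrtr_sqr gtr0_norm; last by lra.
by field; apply/andP; split; apply/eqP; nra.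
Qed.

(* The end condition 2 x cos u sin (N u) = sin (2 k u), N = 2 k - 1, on an
   eigenvector, for x = (- 1 + s sqrt (1 + cos^2 u) / cos u) / 2 and s = 1 or
   s = -1; freed of its denominator it makes sense up to u = pi / 2. *)
Definition char_eq (R : realType) (k : nat) (s u : R) : R :=
  (s * Num.sqrt (1 + cos u ^+ 2) - 2 * cos u) * sin ((2 * k - 1)%:R * u) -
  cos ((2 * k - 1)%:R * u) * sin u.

Lemma char_eq_continuous (R : realType) (k : nat) (s : R) :
  continuous (@char_eq R k s).
Proof.
move=> x.
have cN : {for x, continuous (fun u : R => (2 * k - 1)%:R * u)}.
  by apply: cvgM; [exact: cvg_cst | exact: cvg_id].
apply: cvgB; apply: cvgM.
- apply: cvgB; last first.
    by apply: cvgM; [exact: cvg_cst | exact: continuous_cos].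
  apply: cvgM; first exact: cvg_cst.
  apply: (continuous_comp (f := fun u : R => 1 + cos u ^+ 2)); last exact: sqrt_continuous.
  apply: cvgD; first exact: cvg_cst.
  by apply: cvgM; exact: continuous_cos.
- by apply: continuous_comp; [exact: cN | exact: continuous_sin].
- by apply: continuous_comp; [exact: cN | exact: continuous_cos].
- exact: continuous_sin.
Qed.

Lemma char_eq_eigenvalue (R : realType) (n k : nat) (e : rel 'I_n)
    (rk : 'I_n -> 'I_n) (s u : R) :
  n = (2 * k)%N -> (1 <= k)%N -> bijective rk ->
  (forall i j, e i j = (i != j) && (n - 1 <= rk i + rk j)%N) ->
  s ^+ 2 = 1 -> 0 < u < pi / 2 -> char_eq k s u = 0 ->
  eigenvalue (adjacency R e) ((-1 + s * (Num.sqrt (1 + cos u ^+ 2) / cos u)) / 2).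
Proof.
move=> nE k1 rk_bij eE s2 /andP[u0 upi] H0.
have c0 : 0 < cos u by apply: cos_gt0_pihalf; apply/andP; split; lra.
have su : 0 < sin u by apply: sin_gt0_pi; apply/andP; split; lra.
have q2 : Num.sqrt (1 + cos u ^+ 2) ^+ 2 = 1 + cos u ^+ 2.
  by rewrite sqr_sqrtr // addr_ge0 ?sqr_ge0.
apply: (eigenvalue_antiregular (u := u) nE k1 rk_bij eE).
- by rewrite sin_mulr2n mulrn_eq0 /= mulf_neq0 // gt_eqF.
- by field: s2 q2; rewrite gt_eqF.
have -> : (2 * k)%:R * u = (2 * k - 1)%:R * u + u.
  by rewrite [in LHS](_ : 2 * k = 2 * k - 1 + 1)%N; [rewrite natrD; ring | lia].
(* The two sides of the end condition differ by exactly [char_eq k s u]. *)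
rewrite sinD -[RHS]addr0 -H0 /char_eq.
by field; rewrite gt_eqF.
Qed.

(* Sign changes of [char_eq]: pi j / N for 0 < j < k. At u = 0 it vanishes, hence
   the first node pi / (2 N); the last, pi / 2, is theta = pi. *)
Definition node (R : realType) (k j : nat) : R :=
  if j == 0%N then pi / 2 / (2 * k - 1)%:R
  else if j == k then pi / 2 else j%:R * pi / (2 * k - 1)%:R.
Arguments node : clear implicits.

Lemma sin_natpi (R : realType) (j : nat) : sin (j%:R * pi : R) = 0.
Proof.
elim: j => [|j IH]; first by rewrite mul0r sin0.
by rewrite -natr1 mulrDl mul1r sinDpi IH oppr0.
Qed.

Lemma cos_natpi (R : realType) (j : nat) : cos (j%:R * pi : R) = (-1) ^+ j.
Proof.
elim: j => [|j IH]; first by rewrite mul0r cos0.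
by rewrite -natr1 mulrDl mul1r cosDpi IH exprS mulN1r.
Qed.

Lemma node_mid (R : realType) (k j : nat) : (0 < j < k)%N ->
  node R k j = j%:R * pi / (2 * k - 1)%:R.
Proof. by move=> jk; rewrite /node !ifF //; lia. Qed.

Lemma node_itv (R : realType) (k j : nat) : (2 <= k)%N -> (j <= k)%N ->
  0 < node R k j <= pi / 2 /\ ((j < k)%N -> node R k j < pi / 2).
Proof.
move=> k2 jk; have pi0 := pi_gt0 R.
have N3 : 3%:R <= (2 * k - 1)%:R :> R by rewrite ler_nat; lia.
rewrite /node; case: eqVneq => [->|j0].
  have : 0 < (pi : R) / 2 / (2 * k - 1)%:R < pi / 2.
    apply/andP; split; first by apply: divr_gt0; lra.
    by rewrite ltr_pdivrMr; nra.
  by move=> /andP[-> lt]; rewrite ltW.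
case: eqVneq => [->|jk']; first by rewrite ltnn lexx andbT; split => //; lra.
have : 0 < j%:R * (pi : R) / (2 * k - 1)%:R < pi / 2.
  have j1 : 1%:R <= j%:R :> R by rewrite ler_nat; lia.
  have jN : j%:R * 2 + 1 <= (2 * k - 1)%:R :> R.
    by rewrite -natrM natr1 ler_nat; lia.
  apply/andP; split; first by apply: divr_gt0; nra.
  by rewrite ltr_pdivrMr; nra.
by move=> /andP[-> lt]; rewrite ltW.
Qed.

Lemma node_lt (R : realType) (k j : nat) : (2 <= k)%N -> (j < k)%N ->
  node R k j < node R k j.+1.
Proof.
move=> k2 jk; have pi0 := pi_gt0 R.
have N3 : 3%:R <= (2 * k - 1)%:R :> R by rewrite ler_nat; lia.
have [_ lt_pi] := @node_itv R k j k2 (ltnW jk).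
have [jk1|jk1] := eqVneq j.+1 k.
  by rewrite {2}/node jk1 eqxx ifF ?lt_pi //; lia.
rewrite (@node_mid _ _ j.+1); last by lia.
rewrite /node; case: eqVneq => [->|j0].
  by rewrite ltr_pM2r ?invr_gt0; lra.
by rewrite ifF ?ltr_pM2r ?invr_gt0 ?ltr_nat //; [lra | lia].
Qed.

(** At a node pi j / N the sine of N u vanishes and only a multiple of sin u remains. At pi / 2 the
    value is - s (-1)^k, so the last sign change exists for s = 1 only; hence one root fewer for s =
    -1. *)
Lemma char_eq_node (R : realType) (k j : nat) (s : R) :
  (2 <= k)%N -> (j <= k)%N -> s = 1 \/ s = -1 /\ (j < k)%N ->
  char_eq k s (node R k j) * (-1) ^+ j < 0.
Proof.
move=> k2 jk hs; have pi0 := pi_gt0 R.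
have N3 : 3%:R <= (2 * k - 1)%:R :> R by rewrite ler_nat; lia.
have N0 : (2 * k - 1)%:R != 0 :> R by rewrite gt_eqF; lra.
have [/andP[p0 p_le] p_lt] := @node_itv R k j k2 jk.
move: p0 p_le p_lt; rewrite /char_eq /node; case: eqVneq => [->|j0].
  set u := pi / 2 / _ => u0 _ /(_ (ltnW k2)) u_lt.
  have -> : (2 * k - 1)%:R * u = pi / 2 by rewrite /u; field.
  rewrite sin_pihalf cos_pihalf mul0r subr0 !mulr1.
  have c0 : 0 < cos u by apply: cos_gt0_pihalf; apply/andP; split; lra.
  (* As N >= 3, the angle 2 u = pi / N is below pi / 2. Thus 2 cos^2 u > 1, which is enough for sqrt
     (1 + cos^2 u) < 2 cos u. *)
  have cc : 0 < cos (u *+ 2).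
    apply: cos_gt0_pihalf; apply/andP; split; first by lra.
    have : (2 * k - 1)%:R * u = pi / 2 by rewrite /u; field.
    by nra.
  rewrite cos_mulr2n in cc.
  have q0 : 0 <= Num.sqrt (1 + cos u ^+ 2) by exact: sqrtr_ge0.
  have q2 : Num.sqrt (1 + cos u ^+ 2) ^+ 2 = 1 + cos u ^+ 2.
    by rewrite sqr_sqrtr // addr_ge0 ?sqr_ge0.
  have q_lt : Num.sqrt (1 + cos u ^+ 2) < 2 * cos u by nra.
  by case: hs => [->|[-> _]]; lra.
case: eqVneq => [jkE _ _ _|jk'].
  case: hs => [->|[_]]; last by rewrite jkE ltnn.
  have -> : (2 * k - 1)%:R * (pi / 2) = k%:R * pi - pi / 2 :> R.
    by rewrite natrB ?natrM; [field | lia].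
  rewrite sinB cosB sin_natpi cos_natpi sin_pihalf cos_pihalf jkE.
  rewrite expr0n addr0 sqrtr1.
  have : (-1) ^+ k * (-1) ^+ k = 1 :> R by rewrite -expr2 sqrr_sign.
  by nra.
move=> u0 _ u_lt'; have u_lt := u_lt' ltac:(lia).
set u := _ / _ in u0 u_lt *.
have -> : (2 * k - 1)%:R * u = j%:R * pi by rewrite /u; field.
rewrite sin_natpi cos_natpi mulr0 sub0r mulNr mulrAC -expr2 sqrr_sign mul1r.
by rewrite oppr_lt0 sin_gt0_pi //; apply/andP; split; lra.
Qed.

Lemma char_eq_roots (R : realType) (k m : nat) (s : R) :
  (2 <= k)%N -> (m <= k)%N -> s = 1 \/ s = -1 /\ (m < k)%N ->
  exists u : nat -> R, forall j, (1 <= j <= m)%N ->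
    node R k j.-1 < u j < node R k j /\ char_eq k s (u j) = 0.
Proof.
move=> k2 mk hs.
suff /choice[u hu] : forall j, exists u : R, (1 <= j <= m)%N ->
    node R k j.-1 < u < node R k j /\ char_eq k s u = 0 by exists u.
move=> [|j]; first by exists 0.
have [jm|jm] := leqP j.+1 m; last by exists 0; lia.
have neg i : (i <= j.+1)%N -> char_eq k s (node R k i) * (-1) ^+ i < 0.
  move=> ij; apply: char_eq_node => //; first by lia.
  by case: hs => [|[sN mk']]; [left | right; split => //; lia].
have nj : node R k j < node R k j.+1 by apply: node_lt => //; lia.
have h0 := neg j (leqnSn j); have h1 := neg j.+1 (leqnn _).
rewrite exprS mulN1r mulrN in h1.
have [|u uI u0] := @IVT R (char_eq k s) _ _ 0 (ltW nj)
    (continuous_subspaceT (@char_eq_continuous R k s)).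
  rewrite ge_min le_max; move: h0 h1; rewrite -signr_odd.
  by case: (odd j); rewrite ?expr1 ?expr0 => h0 h1; apply/andP; split; apply/orP; lra.
exists u => _; split=> //=; rewrite in_itv /= in uI; case/andP: uI => ju uj.
(* The root is interior because [char_eq] is nonzero at both nodes. *)
rewrite !lt_neqAle ju uj !andbT; apply/andP; split; apply/eqP => uE; subst u.
  by rewrite u0 mul0r ltxx in h0.
by rewrite u0 mul0r oppr0 ltxx in h1.
Qed.

(** * Matching the roots with the ordered eigenvalues *)

Lemma node_le (R : realType) (k i j : nat) : (2 <= k)%N -> (i <= j <= k)%N ->
  node R k i <= node R k j.
Proof.
move=> k2 /andP[]; elim: j => [|j IH] ij jk; first by rewrite (_ : i = 0%N) //; lia.
have [->//|ij'] := eqVneq i j.+1.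
by apply: le_trans (IH _ _) (ltW (node_lt _ _ _)); lia.
Qed.

(** The index map [c] with m j = l (c j) is a strictly increasing map of 1, ..., k into itself,
    hence the identity: induction from the bottom gives [c_ge], from the top [c_le]. *)
Lemma increasing_enum (R : realType) (k : nat) (l m : nat -> R) :
  (forall i j, (1 <= i)%N -> (i < j)%N -> (j <= k)%N -> l i < l j) ->
  (forall i j, (1 <= i)%N -> (i < j)%N -> (j <= k)%N -> m i < m j) ->
  (forall j, (1 <= j <= k)%N -> exists i, (1 <= i <= k)%N /\ m j = l i) ->
  forall j, (1 <= j <= k)%N -> m j = l j.
Proof.
move=> l_lt m_lt ml.
have /choice[c hc] : forall j, exists i, (1 <= j <= k)%N -> (1 <= i <= k)%N /\ m j = l i.
  move=> j; have [/ml[i hi]|_] := boolP (1 <= j <= k)%N; first by exists i.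
  by exists 0%N.
have c_lt i j : (1 <= i)%N -> (i < j)%N -> (j <= k)%N -> (c i < c j)%N.
  move=> i1 ij jk; have [|ci mi] := hc i; first by lia.
  have [|cj mj] := hc j; first by lia.
  have := m_lt i j i1 ij jk; rewrite mi mj; apply: contraTltn => cji; rewrite -leNgt.
  move: cji; rewrite leq_eqVlt => /predU1P[->//|cji].
  by apply/ltW/l_lt => //; lia.
have c_ge j : (1 <= j <= k)%N -> (j <= c j)%N.
  elim: j => [//|j IH] jk; have [j0|j0] := posnP j.
    by have [] := hc _ jk; lia.
  by have := c_lt j j.+1 j0 (leqnn _); have := IH; lia.
have c_le d : (d < k)%N -> (c (k - d) <= k - d)%N.
  elim: d => [|d IH] dk; first by have [|] := hc (k - 0)%N; lia.
  have := IH (ltnW dk); have := c_lt (k - d.+1)%N (k - d)%N; lia.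
move=> j jk; have [_ ->] := hc j jk; congr l.
by have := c_ge j jk; have := c_le (k - j)%N; rewrite subKn; lia.
Qed.

Lemma positive_eigenvalue_f1 (R : realType) (n k : nat) (e : rel 'I_n)
    (l : nat -> R) :
  n = (2 * k)%N -> (2 <= k)%N -> is_A e ->
  positive_eigenvalues (adjacency R e) k l ->
  forall j, (1 <= j <= k)%N -> exists2 u : R,
    node R k j.-1 < u < node R k j & l j = f1 R (u *+ 2).
Proof.
move=> nE k2 he [l_lt lP].
have [rk [rk_bij eE]] := antiregular_rank nE (ltnW k2) he.
have [u uP] := char_eq_roots k2 (leqnn k) (or_introl (erefl (1 : R))).
have u_itv j : (1 <= j <= k)%N -> 0 < u j < pi / 2.
  move=> jk; have [/andP[u1 u2] _] := uP j jk.
  have [|/andP[n1 _] _] := @node_itv R k j.-1 k2; first by lia.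
  have [|/andP[_ n2] _] := @node_itv R k j k2; first by lia.
  by apply/andP; split; lra.
move=> j jk; exists (u j); first by have [] := uP j jk.
symmetry; move: j jk.
apply: increasing_enum l_lt _ _ => [i j i1 ij jk|j jk].
  have /andP[ui _] : 0 < u i < pi / 2 by apply: u_itv; lia.
  have /andP[_ uj] : 0 < u j < pi / 2 by apply: u_itv; lia.
  have [|/andP[_ ui2] _] := uP i; first by lia.
  have [|/andP[uj1 _] _] := uP j; first by lia.
  (* The roots lie in disjoint intervals between nodes, so they are ordered like their indices. *)
  have ij' : node R k i <= node R k j.-1 by apply: node_le => //; lia.
  by apply: f1_lt; rewrite ?mulr2n; lra.
apply/lP; rewrite f1_double; last exact: u_itv.
have [_ uj0] := uP j jk.
split.
  have := char_eq_eigenvalue nE (ltnW k2) rk_bij eE (expr1n _ _) (u_itv j jk) uj0.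
  by rewrite mul1r.
have /andP[u0 upi] := u_itv j jk.
have c0 : 0 < cos (u j) by apply: cos_gt0_pihalf; apply/andP; split; lra.
rewrite divr_gt0 // addrC subr_gt0 ltr_pdivlMr // mul1r.
rewrite -[X in X < _](gtr0_norm c0) -sqrtr_sqr ltr_sqrt; first by lra.
by rewrite ltr_pwDl ?sqr_ge0.
Qed.

Lemma negative_eigenvalue_f1 (R : realType) (n k : nat) (e : rel 'I_n)
    (l : nat -> R) :
  n = (2 * k)%N -> (2 <= k)%N -> is_A e ->
  negative_eigenvalues (adjacency R e) (k - 1) l ->
  forall j, (1 <= j <= k - 1)%N -> exists2 u : R,
    node R k j.-1 < u < node R k j & l j = - 1 - f1 R (u *+ 2).
Proof.
move=> nE k2 he [l_lt lP].
have [rk [rk_bij eE]] := antiregular_rank nE (ltnW k2) he.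
have [||u uP] := @char_eq_roots R k (k - 1) (- 1) k2; first by lia.
  by right; split => //; lia.
have u_itv j : (1 <= j <= k - 1)%N -> 0 < u j < pi / 2.
  move=> jk; have [/andP[u1 u2] _] := uP j jk.
  have [|/andP[n1 _] _] := @node_itv R k j.-1 k2; first by lia.
  have [|/andP[_ n2] _] := @node_itv R k j k2; first by lia.
  by apply/andP; split; lra.
move=> j jk; exists (u j); first by have [] := uP j jk.
(* Negation turns the decreasing list [l] into an increasing one, as [increasing_enum] requires. *)
suff /(_ j jk) : forall j, (1 <= j <= k - 1)%N -> 1 + f1 R (u j *+ 2) = - l j by lra.
move=> {j jk}; apply: increasing_enum => [i j i1 ij jk|i j i1 ij jk|j jk].
- by rewrite ltrN2 l_lt.
- have /andP[ui _] : 0 < u i < pi / 2 by apply: u_itv; lia.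
  have /andP[_ uj] : 0 < u j < pi / 2 by apply: u_itv; lia.
  have [|/andP[_ ui2] _] := uP i; first by lia.
  have [|/andP[uj1 _] _] := uP j; first by lia.
  have ij' : node R k i <= node R k j.-1 by apply: node_le => //; lia.
  by rewrite ltrD2l; apply: f1_lt; rewrite ?mulr2n; lra.
suff /lP[i [ik iE]] : [/\ eigenvalue (adjacency R e) (- 1 - f1 R (u j *+ 2)),
    - 1 - f1 R (u j *+ 2) < 0 & - 1 - f1 R (u j *+ 2) <> - 1].
  by exists i; split => //; rewrite -iE; ring.
have [_ uj0] := uP j jk; have /andP[u0 upi] := u_itv j jk.
have c0 : 0 < cos (u j) by apply: cos_gt0_pihalf; apply/andP; split; lra.
have q1 : 1 < Num.sqrt (1 + cos (u j) ^+ 2) / cos (u j).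
  rewrite ltr_pdivlMr // mul1r.
  rewrite -[X in X < _](gtr0_norm c0) -sqrtr_sqr ltr_sqrt; first by lra.
  by rewrite ltr_pwDl ?sqr_ge0.
rewrite f1_double; last exact: u_itv.
split; [|lra|lra].
have := char_eq_eigenvalue nE (ltnW k2) rk_bij eE (etrans (sqrrN 1) (expr1n _ 2))
  (u_itv j jk) uj0.
by congr eigenvalue; field; rewrite gt_eqF.
Qed.

(** * The bound on the asymmetry *)

Lemma gamma_node (R : realType) (k j : nat) : (0 < j < k)%N ->
  gamma R k j = 2 * node R k j.
Proof.
move=> jk; rewrite node_mid // /gamma natrB ?natrM; last by lia.
ring.
Qed.

Lemma node_gap (R : realType) (k j : nat) : (0 < j < k)%N ->
  node R k j - node R k j.-1 <= pi / (2 * k%:R - 1).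
Proof.
move=> jk; have pi0 := pi_gt0 R.
have k2 : 2 <= k%:R :> R by rewrite ler_nat; lia.
rewrite node_mid // natrB ?natrM; last by lia.
(* The interval for [j = 1] starts at pi / (2 N), so it has only half the regular length pi / N. *)
have [->|j1] := eqVneq j 1%N.
  by rewrite lerBlDr mul1r lerDl /node eqxx !divr_ge0 // ?subr_ge0 ?ler1n; lra.
rewrite node_mid; last by lia.
rewrite natrB ?natrM; last by lia.
have -> : j%:R = j.-1%:R + 1 :> R by rewrite natr1 prednK //; lia.
by rewrite -!mulrBl addrAC subrr add0r mul1r.
Qed.

Lemma eigenvalue_asymmetry (R : realType) (k : nat) (e : rel 'I_(2 * k))
    (lp lm : nat -> R) : is_A e ->
  positive_eigenvalues (adjacency R e) k lp ->
  negative_eigenvalues (adjacency R e) (k - 1) lm ->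
  forall j, (1 <= j <= k - 1)%N -> 0 < gamma R k j < pi /\
    `|lp j + lm j + 1|
      <= 4 * pi * derive1 (f1 R) (gamma R k j) / (2 * k%:R - 1).
Proof.
move=> he hlp hlm j jk; have pi0 := pi_gt0 R.
have k2 : (2 <= k)%N by lia.
have k2R : 2 <= k%:R :> R by rewrite ler_nat.
have jk' : (0 < j < k)%N by lia.
have [|u /andP[u1 u2] ->] := positive_eigenvalue_f1 (erefl _) k2 he hlp (j := j).
  by lia.
have [|v /andP[v1 v2] ->] := negative_eigenvalue_f1 (erefl _) k2 he hlm (j := j).
  by lia.
have gap := node_gap R jk'.
have [|/andP[n0 _] _] := @node_itv R k j.-1 k2; first by lia.
have [|/andP[n1 _] n2] := @node_itv R k j k2; first by lia.
have {}n2 := n2 ltac:(lia).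
have g0 : 0 < gamma R k j < pi by rewrite gamma_node //; apply/andP; split; lra.
split=> //; have g'0 := derive1_f1_gt0 g0; case/andP: g0 => g0 gpi.
have -> : f1 R (u *+ 2) + (- 1 - f1 R (v *+ 2)) + 1 = f1 R (u *+ 2) - f1 R (v *+ 2).
  by ring.
apply: le_trans (f1_lipschitz (c := gamma R k j) _ _ gpi) _.
- by rewrite gamma_node // mulr2n; apply/andP; split; lra.
- by rewrite gamma_node // mulr2n; apply/andP; split; lra.
(* Both 2 u and 2 v lie in an interval of length at most 2 pi / N, within the 4 pi / N allowed. *)
have -> (g' : R) : 4 * pi * g' / (2 * k%:R - 1) = g' * (4 * (pi / (2 * k%:R - 1))).
  by ring.
rewrite ler_wpM2l ?(ltW g'0) // ler_norml.
have : 0 < pi / (2 * k%:R - 1) :> R by apply: divr_gt0; lra.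
by rewrite !mulr2n => d0; apply/andP; split; lra.
Qed.

Theorem theorem6p1 (R : realType) (k : nat) (hk : (1 <= k)%N)
    (e : rel 'I_(2 * k)) (he : is_A e) (lp lm : nat -> R)
    (hlp : positive_eigenvalues (adjacency R e) k lp)
    (hlm : negative_eigenvalues (adjacency R e) (k - 1) lm) :
  (forall j : nat, (1 <= j <= k - 1)%N ->
     `|lp j + lm j + 1|
       <= 4 * pi * derive1 (f1 R) (gamma R k j) / (2 * k%:R - 1)) /\
  (forall r eps : R, 0 < r < 1 -> 0 < eps ->
     4 * pi * derive1 (f1 R) (r * pi) / (2 * k%:R - 1) < eps ->
     forall j : nat, (1 <= j)%N -> j%:R <= (2 * k%:R - 1) * r / 2 ->
       `|lp j + lm j + 1| < eps).
Proof.
have asym := eigenvalue_asymmetry he hlp hlm.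
split=> [j /asym[] //|r eps /andP[r0 r1] eps0 r_eps j j1 jr].
have pi0 := pi_gt0 R; have k1 : 1 <= k%:R :> R by rewrite ler1n.
(* Since r < 1, [j] is below N / 2 = k - 1 / 2. *)
have jk : (j < k)%N by rewrite -(ltr_nat R); nra.
have [|/andP[g0 gpi] le_g] := asym j; first by lia.
apply: le_lt_trans le_g (le_lt_trans _ r_eps).
rewrite ler_pM2r ?invr_gt0; last by lra.
rewrite ler_pM2l; last by lra.
(* The upper bound on [j] is equivalent to gamma_j <= r pi. *)
apply: derive1_f1_le => //; last by nra.
by rewrite /gamma ler_pdivrMr; nra.
Qed.
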